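(* Let $s, i, d, k, n$ be integers with $1\le d<k<n$, $1\leq s\leq i$, $\lfloor (d+1)/2\rfloor\leq i\leq d<k$ and $n-k-s(k+d-2i)\geq d-i$. Put $$e_1=\binom{k-s}{d-s}-1,\qquad e_2=\binom{k-s}{i-s}\binom{n-k-s(k+d-2i)}{d-i}-1 .$$ Then: (i) the matrix $M(i;d,k,n)$ is $s^{e_2}$-disjunct; (ii) for given $k$ (and given $d,i,s$ satisfying the conditions above), if $i<d$, then $$\lim_{n\rightarrow\infty}\frac{e_2+1}{e_1+1}=\infty .$$
   Context: For a positive integer $n$, $[n]=\{1,2,\ldots,n\}$, and $\binom{[n]}{k}$ denotes the set of all $k$-element subsets of $[n]$. For integers $1\leq d<k<n$ and $0\leq i\leq d$, $M(i;d,k,n)$ is the binary matrix with rows indexed by $\binom{[n]}{d}$ and columns indexed by $\binom{[n]}{k}$, whose entry at $(A,B)$, for $A\in\binom{[n]}{d}$ and $B\in\binom{[n]}{k}$, is $1$ if $|A\cap B|=i$ and $0$ otherwise. A binary matrix $M$ is called $s^e$-disjunct if, given any $s+1$ (distinct) columns of $M$ with one of them designated, there are (at least) $e+1$ rows having a $1$ in the designated column and a $0$ in each of the other $s$ columns. *)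

(* Defs.v *)
From mathcomp Require Import all_boot all_order all_algebra.
From mathcomp Require Import all_classical all_reals all_analysis.

Set Implicit Arguments.
Unset Strict Implicit.
Unset Printing Implicit Defensive.

Local Open Scope nat_scope.

(* The ground set [n] = {1, ..., n} is modelled by 'I_n = {0, ..., n-1}. *)
Definition ksubset (n k : nat) : finType := {A : {set 'I_n} | #|A| == k}.

(* true stands for the entry 1 and false for the entry 0. *)
Definition binary_matrix (Row Col : finType) : Type := Row -> Col -> bool.

Definition intersection_matrix (i d k n : nat) :
    binary_matrix (ksubset n d) (ksubset n k) :=
  fun A B => #|val A :&: val B| == i.
Arguments intersection_matrix : clear implicits.

(* c is the designated column and S the set of the s other columns. *)
Definition disjunct (Row Col : finType) (s e : nat)
    (M : binary_matrix Row Col) : Prop :=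
  forall (c : Col) (S : {set Col}), c \notin S -> #|S| = s ->
    e + 1 <= #|[set r : Row | M r c && [forall c' in S, ~~ M r c']]|.

(* For 1 <= s <= i <= d < k and k + s * (k + d - 2 * i) + (d - i) <= n, no
   subtraction of natural numbers in e1 and e2 is truncated. *)
Definition e1 (s d k : nat) : nat := 'C(k - s, d - s) - 1.

Definition e2 (s i d k n : nat) : nat :=
  'C(k - s, i - s) * 'C(n - k - s * (k + d - 2 * i), d - i) - 1.

(* Main.v *)
(* For each other column C pick a point of B outside C, and extend these points
   to an s-subset X of B.  The rows counted are the sets A = X + P + D, where P
   is an (i - s)-subset of B - X and D is a (d - i)-subset of the complement of
   B which avoids every column C with |B :&: C| >= 2i - d; such a C has at most
   k + d - 2i points outside B.  For these C, A :&: C is contained in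
   (X + P) :&: C, which misses a point of X; for the remaining C,
   |A :&: C| <= |B :&: C| + |D| < i. *)
Require Import Defs.
From mathcomp Require Import all_boot all_order all_algebra.
From mathcomp Require Import all_classical all_reals all_analysis.
(* Restores the lemma names on finite sets that classical_sets shadows. *)
From mathcomp Require Import fintype finset.
From mathcomp Require Import zify.
Import Order.TTheory GRing.Theory Num.Theory.
Import numFieldNormedType.Exports.

Lemma subset_of_card (T : finType) (A : {set T}) (m : nat) :
  m <= #|A| -> exists2 P : {set T}, P \subset A & #|P| = m.
Proof.
move=> mA; have : 0 < 'C(#|A|, m) by rewrite bin_gt0.
rewrite -cards_draws => /card_gt0P[P]; rewrite inE => /andP[PA /eqP Pm].
by exists P.
Qed.

Lemma superset_of_card (T : finType) (X B : {set T}) (m : nat) :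
    X \subset B -> #|X| <= m <= #|B| ->
  exists Y : {set T}, [/\ X \subset Y, Y \subset B & #|Y| = m].
Proof.
move=> XB /andP[Xm mB].
have [|P PBX Pm] := @subset_of_card _ (B :\: X) (m - #|X|).
  by rewrite cardsDS // leq_sub2r.
have /andP[PB PX] : (P \subset B) && [disjoint P & X] by rewrite -subsetD.
exists (X :|: P); split; first exact: subsetUl.
  by rewrite subUset XB.
rewrite cardsU Pm setIC (disjoint_setI0 PX) cards0; lia.
Qed.

(** Choose for each C in F a point of B outside C. Distinct members may share a point, so the image
    of the choice only has size at most |F|. *)
Lemma small_transversal (T : finType) (B : {set T}) (F : {set {set T}}) :
    (forall C, C \in F -> ~~ (B \subset C)) ->
  exists X : {set T}, [/\ X \subset B, #|X| <= #|F| &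
    forall C, C \in F -> ~~ (X \subset C)].
Proof.
move=> BF.
(* T may be empty, so the default value [x0] of the choice function has to come from a member of
   F. *)
have [->|[C0 C0F]] := set_0Vmem F.
  by exists set0; split=> [||C]; rewrite ?sub0set ?cards0 // inE.
have /subsetPn[x0 _ _] := BF _ C0F.
pose f C := odflt x0 [pick x in B :\: C].
have fP C : C \in F -> f C \in B :\: C.
  move=> /BF/subsetPn[x xB xC]; rewrite /f.
  by case: pickP => //= /(_ x); rewrite inE xB xC.
exists (f @: F); split; last 1 first.
- move=> C CF; apply/subsetPn; exists (f C); first exact: imset_f.
  by have := fP C CF; rewrite inE => /andP[].
- apply/subsetP => _ /imsetP[C CF ->].
  by have := fP C CF; rewrite inE => /andP[].
- exact: leq_imset_card.
Qed.

Lemma card_bigcup_le (I T : finType) (F : {set I}) (G : I -> {set T}) (m : nat) :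
  (forall C, C \in F -> #|G C| <= m) -> #|\bigcup_(C in F) G C| <= #|F| * m.
Proof.
move=> Gm; rewrite -sum_nat_const.
elim/big_rec2: _ => [|C p A /Gm Cm Ap]; first by rewrite cards0.
by rewrite cardsU; lia.
Qed.

(** The pair (P, D) is recovered from X + P + D by intersecting with B and with W, so the union map
    is injective on pairs. *)
Lemma card_setU_draws (T : finType) (X B W : {set T}) (p q : nat) :
    [disjoint B & X] -> [disjoint W & X] -> [disjoint B & W] ->
  #|[set X :|: (P :|: D) | P in [set P : {set T} | P \subset B & #|P| == p],
       D in [set D : {set T} | D \subset W & #|D| == q]]|
    = 'C(#|B|, p) * 'C(#|W|, q).
Proof.
move=> BX WX BW.
rewrite -!cards_draws -cardsX curry_imset2X card_in_imset //.
have split_union (P D : {set T}) : P \subset B -> D \subset W ->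
    (X :|: (P :|: D)) :&: B = P /\ (X :|: (P :|: D)) :&: W = D.
  move=> PB DW; rewrite !setIUl.
  rewrite (setIC X) (disjoint_setI0 BX) (setIC X) (disjoint_setI0 WX).
  rewrite (setIidPl PB) (setIidPl DW).
  rewrite (disjoint_setI0 (disjointWl PB BW)) [D :&: B]setIC.
  by rewrite (disjoint_setI0 (disjointWr DW BW)) !set0U setU0.
move=> [P D] [P' D']; rewrite !inE /=.
move=> /andP[/andP[PB _] /andP[DW _]] /andP[/andP[P'B _] /andP[D'W _]] eqA.
have [PE DE] := split_union _ _ PB DW.
have [P'E D'E] := split_union _ _ P'B D'W.
by congr pair; [rewrite -PE eqA | rewrite -DE eqA].
Qed.

Lemma card_separating_sets (T : finType) (B : {set T}) (F : {set {set T}})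
    (i d k : nat) :
    #|B| = k -> (forall C, C \in F -> #|C| = k) -> B \notin F ->
    #|F| <= i -> i <= d -> d < k -> d <= 2 * i ->
  'C(k - #|F|, i - #|F|) * 'C(#|T| - k - #|F| * (k + d - 2 * i), d - i) <=
  #|[set A : {set T} | [&& #|A| == d, #|A :&: B| == i &
                         [forall C in F, #|A :&: C| != i]]]|.
Proof.
move=> Bk Fk BF Fi id dk d2i.
have [|X0 [X0B X0F X0sep]] := @small_transversal T B F.
  (* All the sets have size k, so a C containing B would equal B, which is not in F. *)
  move=> C CF; apply: contra BF => BC.
  suff -> : B = C by [].
  by apply/eqP; rewrite eqEcard BC Bk (Fk C CF) leqnn.
(* Padding to exactly |F| points fixes the size of X, and a superset of [X0] still lies in no member
   of F. *)
have [|X [X0X XB Xs]] := superset_of_card _ _ _ #|F| X0B.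
  by rewrite X0F Bk; lia.
have Xsep C : C \in F -> ~~ (X \subset C).
  by move=> /X0sep; apply: contra; apply: subset_trans.
pose G := [set C in F | 2 * i <= #|B :&: C| + d].
(* For C in [G], |C| = k and |B :&: C| >= 2i - d leave at most k + d - 2i points of C outside B. *)
pose U := \bigcup_(C in G) (C :\: B).
pose W := ~: (B :|: U).
have WB : [disjoint B & W].
  by rewrite disjoints_subset /W setCK; apply: subsetUl.
have cardU : #|U| <= #|F| * (k + d - 2 * i).
  apply: (@leq_trans (#|G| * (k + d - 2 * i))).
    apply: card_bigcup_le => C; rewrite inE => /andP[CF BC].
    by rewrite cardsD (Fk C CF) setIC; lia.
  by rewrite leq_mul2r subset_leq_card ?orbT //; apply/subsetP => C;
    rewrite inE => /andP[].
have cardW : #|T| - k - #|F| * (k + d - 2 * i) <= #|W|.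
  have := cardsC (B :|: U); rewrite -/W cardsU Bk; lia.
apply: (@leq_trans ('C(#|B :\: X|, i - #|F|) * 'C(#|W|, d - i))).
  by rewrite cardsDS // Bk Xs leq_mul2l leq_bin2l ?orbT.
have BX : [disjoint B :\: X & X].
  by rewrite disjoints_subset setDE subsetIr.
have WX : [disjoint W & X].
  by rewrite disjoint_sym; exact: disjointWl XB WB.
have BXW : [disjoint B :\: X & W] by exact: disjointWl (subsetDl B X) WB.
rewrite -(card_setU_draws _ _ _ _ _ _ BX WX BXW).
apply/subset_leq_card/subsetP => _ /imset2P[P D + + ->].
rewrite !inE => /andP[PBX /eqP cP] /andP[DW /eqP cD].
have /andP[PB PX] : (P \subset B) && [disjoint P & X] by rewrite -subsetD.
have cXP : #|X :|: P| = i.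
  by rewrite cardsU setIC (disjoint_setI0 PX) cards0 Xs cP subn0 subnKC.
have XPB : X :|: P \subset B by rewrite subUset XB.
have DB : D :&: B = set0.
  by rewrite setIC; apply: disjoint_setI0; exact: disjointWr DW WB.
have AB : (X :|: (P :|: D)) :&: B = X :|: P.
  by rewrite setUA setIUl (setIidPl XPB) DB setU0.
apply/and3P; split; last apply/forallP => C.
- rewrite setUA cardsU cXP cD.
  suff -> : (X :|: P) :&: D = set0 by rewrite cards0 subn0 subnKC.
  by apply/eqP; rewrite -subset0 -DB (setIC D) setSI.
- by rewrite AB cXP.
apply/implyP => CF; rewrite setUA setIUl.
have cU := cardsU ((X :|: P) :&: C) (D :&: C).
have [BC|BC] := leqP (2 * i) (#|B :&: C| + d).
  have -> : D :&: C = set0.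
    apply/eqP; rewrite -subset0; apply/subsetP => x /setIP[xD xC].
    have := subsetP DW _ xD; rewrite !inE negb_or => /andP[xB].
    move=> /bigcupP[]; exists C; first by rewrite inE CF.
    by rewrite inE xB.
  (* The trace of C on the i-set X + P is proper, since equality would put X inside C. *)
  rewrite setU0 neq_ltn -{1}cXP; apply/orP; left; apply: proper_card.
  rewrite properEneq subsetIl andbT.
  apply: contra (Xsep _ CF) => /eqP/setIidPl; apply: subset_trans.
  exact: subsetUl.
(* Here |B :&: C| < 2i - d, and D adds at most d - i points, so the total stays below i. *)
have h1 : #|(X :|: P) :&: C| <= #|B :&: C| by rewrite subset_leq_card // setSI.
have h2 : #|D :&: C| <= d - i by rewrite -cD subset_leq_card // subsetIl.
move: id d2i BC h1 h2 cU; clear; lia.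
Qed.

(** By Pascal's rule, raising m by one adds a positive binomial once the lower index is at most m.
    This crude linear bound is enough for divergence. *)
Lemma leq_sub_bin (m r : nat) : 0 < r -> m - r <= 'C(m, r).
Proof.
case: r => // r _; elim: m => // m IH; rewrite subSS binS.
have [mr|rm] := leqP m r; first by lia.
have : 0 < 'C(m, r) by rewrite bin_gt0 ltnW.
by lia.
Qed.

Lemma disjunct_intersection_matrix (s i d k n : nat) :
    s <= i -> i <= d -> d < k -> d <= 2 * i ->
    d - i <= n - k - s * (k + d - 2 * i) ->
  disjunct s (e2 s i d k n) (intersection_matrix i d k n).
Proof.
move=> si id dk d2i hn c S cS cardS.
set Rows := [set r | _].
have cF : #|val @: S| = s by rewrite card_imset.
have := card_separating_sets _ (val c) (val @: S) i d k.
rewrite cF card_ord (eqP (valP c)) => /(_ erefl) sep.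
have {}sep : 'C(k - s, i - s) * 'C(n - k - s * (k + d - 2 * i), d - i) <=
    #|Rows|.
  (* Rows are elements of a sigma type; the injection [val] carries the count over to plain sets. *)
  rewrite -(card_imset Rows val_inj); apply: leq_trans (sep _ _ si id dk d2i) _.
  - by move=> _ /imsetP[C _ ->]; apply/eqP/(valP C).
  - by rewrite mem_imset.
  apply/subset_leq_card/subsetP => A; rewrite inE => /and3P[cA AB AF].
  apply/imsetP; exists (Sub A cA : ksubset n d); last by rewrite SubK.
  rewrite inE /intersection_matrix SubK AB; apply/forallP => C.
  by apply/implyP => CS; exact: (implyP (forallP AF (val C)) (imset_f _ CS)).
(* Both binomials are positive, so the truncated [- 1] in [e2] is undone exactly by [+ 1]. *)
apply: leq_trans sep; rewrite /e2 subnK // muln_gt0 !bin_gt0 hn andbT.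
by lia.
Qed.

(** The shift is independent of n, as is [e1], so the quotient in the limit grows at least linearly
    in n. *)
Lemma e2_lower_bound (s i d k n : nat) : i <= k -> i < d ->
  n <= e2 s i d k n + 1 + (k + s * (k + d - 2 * i) + (d - i)).
Proof.
move=> ik id; rewrite /e2.
have h1 : 0 < 'C(k - s, i - s) by rewrite bin_gt0 leq_sub2r.
have := @leq_sub_bin (n - k - s * (k + d - 2 * i)) (d - i).
rewrite subn_gt0 id => /(_ isT) h2.
have := leq_pmull 'C(n - k - s * (k + d - 2 * i), d - i) h1.
by lia.
Qed.

Local Open Scope classical_set_scope.
Local Open Scope ring_scope.

Theorem theorem2 (R : realType) (s i d k : nat)
    (hd : (1 <= d)%N) (hdk : (d < k)%N)
    (hs : (1 <= s)%N) (hsi : (s <= i)%N)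
    (hdi : ((d + 1) %/ 2 <= i)%N) (hid : (i <= d)%N) :
  (forall n : nat, (k < n)%N ->
     n%:Z - k%:Z - s%:Z * (k%:Z + d%:Z - 2 * i%:Z) >= d%:Z - i%:Z ->
     disjunct s (e2 s i d k n) (intersection_matrix i d k n))
  /\
  ((i < d)%N ->
     (((e2 s i d k n)%:R + 1) / ((e1 s d k)%:R + 1) : R) @[n --> \oo] --> +oo).
Proof.
split=> [n kn hn|ltid].
  apply: disjunct_intersection_matrix => //; first by lia.
  (* Since 2i <= 2d < k + d, the natural subtraction is exact and the integer hypothesis
     transfers. *)
  have E : (k + d - 2 * i)%N%:Z = k%:Z + d%:Z - 2 * i%:Z by lia.
  by move: hn; rewrite -E -PoszM; lia.
apply/cvgryPge => A.
set E := (e1 s d k)%:R + 1.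
have E0 : 0 < E by rewrite ltr_wpDl.
near=> n.
rewrite ler_pdivlMr //.
have ik : (i <= k)%N by lia.
have := e2_lower_bound s i d k n ik ltid.
(* It suffices that n is at least A * E plus the constant shift. *)
rewrite -(ler_nat R) !natrD -lerBlDr; apply: le_trans.
rewrite lerBrDr; near: n; exact: nbhs_infty_ger.
Unshelve. all: by end_near.
Qed.
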